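(* Let $X$ be a complex topological vector space with $2\leq \dim(X)<\infty$. Then $X$ supports no codiskcyclic $C_0$-semigroup of operators; that is, no $C_0$-semigroup $(T_t)_{t\geq0}$ of operators on $X$ is codiskcyclic.
   Context: Operators are continuous linear operators on $X$. A family $(T_t)_{t\geq0}$ of operators on $X$ is a $C_0$-semigroup if $T_0=I$ (the identity operator), $T_{t+s}=T_tT_s$ for all $t,s\geq0$, and $\lim_{t\to s}T_tx=T_sx$ for all $x\in X$ and $s\geq0$. Put $\mathbb{U}=\{\alpha\in\mathbb{C} : |\alpha|\geq 1\}$. A $C_0$-semigroup $(T_t)_{t\geq0}$ is codiskcyclic if there exists $x\in X$ such that $\{\alpha T_tx : \alpha\in\mathbb{U},\ t\geq0\}$ is dense in $X$. *)

(* Defs.v *)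
From HB Require Import structures.
From mathcomp Require Import all_boot all_order all_algebra.
From mathcomp Require Import complex.
From mathcomp Require Import boolp classical_sets functions set_interval reals.
From mathcomp Require Import topology normedtype.

Set Implicit Arguments.
Unset Strict Implicit.
Unset Printing Implicit Defensive.

Import Order.TTheory GRing.Theory Num.Theory.
Import numFieldNormedType.Exports.

Local Open Scope classical_set_scope.
Local Open Scope ring_scope.
Local Open Scope complex_scope.

#[short(type="finDimTopLmodType")]
HB.structure Definition FinDimTopLmodule (K : numFieldType) :=
  {X of TopologicalLmodule K X & Vector K X}.

Section Codiskcyclic.
Variables (R : realType) (X : topologicalLmodType R[i]).

(* The index set [0, +oo[ is rendered by functions on R of which only the values
   at nonnegative reals are constrained. *)
Record C0_semigroup (T : R -> X -> X) : Prop := {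
  C0_linear : forall t : R, 0 <= t -> linear (T t) ;
  C0_continuous : forall t : R, 0 <= t -> continuous (T t) ;
  C0_id : T 0 = id ;
  C0_comp : forall t s : R, 0 <= t -> 0 <= s -> T (t + s) = T t \o T s ;
  C0_strongly_continuous : forall (x : X) (s : R), 0 <= s ->
    T t x @[t --> within [set u : R | 0 <= u] (nbhs s)] --> T s x
}.

Definition codisk : set R[i] := [set a | 1 <= `|a|].

Definition codiskcyclic (T : R -> X -> X) : Prop :=
  exists x : X, dense [set a *: T t x | a in codisk & t in [set u : R | 0 <= u]].

End Codiskcyclic.

(* Main.v *)
From HB Require Import structures.
Require Import Defs.
From mathcomp Require Import all_boot all_order all_algebra.
From mathcomp Require Import complex.
From mathcomp Require Import boolp classical_sets functions set_interval reals.
From mathcomp Require Import topology normedtype exp.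

(** No orbit is dense even when all complex multiples are allowed, and the
    obstruction already appears on a two-dimensional quotient of X.

    The transposes of the commuting operators T t have a common eigenvector u,
    and a second functional v, independent of u, that is a common eigenvector
    modulo u ([triangular_covectors], from [common_eigenvector_mod]):
    u (T t x) = l t * u x and v (T t x) = m t * v x + n t * u x.  If u x = 0,
    the projective orbit of x stays in the hyperplane u = 0.  Otherwise the
    ratio v / u is unaffected by scalars, and along the orbit of x it is the
    curve z t = v (T t x) / u (T t x) of the complex plane, for which
    z (t + s) = (m t / l t) * z s + n t / l t: the orbit of a point under a
    one-parameter semigroup of affine maps of the plane.

    Such an orbit misses a nonempty open set ([affine_orbit_avoids]).  Either
    all the maps are translations, and Re (z t - z 0) is additive and
    continuous, hence of constant sign, so that z stays in a half-plane; or the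
    maps have a common fixed point p, and the modulus of z t - p is
    multiplicative and continuous, up to a factor, hence monotone, so that z
    avoids a disk around p or stays in one.  The points y with u y != 0 and
    v y / u y in the missed open set then form a nonempty open subset of X that
    the projective orbit does not meet.

    This last step needs u and v to be continuous, which is the theorem that
    linear maps out of a finite-dimensional Hausdorff topological vector space
    are continuous ([linear_continuous_findim]); it rests on the compactness of
    spheres in real coordinates. *)

Set Implicit Arguments.
Unset Strict Implicit.
Unset Printing Implicit Defensive.

Import Order.TTheory GRing.Theory Num.Theory.
Import numFieldNormedType.Exports VectorInternalTheory Normc.

Local Open Scope classical_set_scope.
Local Open Scope ring_scope.
Local Open Scope complex_scope.

(** * Common eigenvectors of commuting matrices modulo an invariant subspace *)

(** A linear factor of the characteristic polynomial must push some vector of W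
    into U: the product of all of them kills everything, by Cayley-Hamilton, so
    the first factor at which the image of a given w outside U enters U
    provides an eigenvector of A on the quotient of W by U. *)
Lemma eigenvector_mod (F : closedFieldType) (n k l : nat) (A : 'M[F]_n)
    (U : 'M[F]_(k, n)) (W : 'M[F]_(l, n)) :
  stablemx W A -> ~~ (W <= U)%MS ->
  exists a, exists2 w : 'rV[F]_n,
    (w <= W)%MS && ~~ (w <= U)%MS & (w *m (A - a%:M) <= U)%MS.
Proof.
case: n A U W => [|n] A U W stabW /row_subPn[i WiU].
  by rewrite thinmx0 sub0mx in WiU.
have [s charA] := closed_field_poly_normal (char_poly A).
rewrite (monicP (char_poly_monic A)) scale1r in charA.
have: (row i W *m \prod_(a <- s) (A - a%:M) <= U)%MS.
  suff -> : \prod_(a <- s) (A - a%:M) = 0 by rewrite mulmx0 sub0mx.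
  rewrite -(Cayley_Hamilton A) charA rmorph_prod /=; apply: eq_bigr => a _.
  by rewrite rmorphB /= horner_mx_X horner_mx_C.
elim: s (row i W) (row_sub i W) WiU {charA} => [|a s IHs] w wW wU.
  by rewrite big_nil mulmx1 (negPf wU).
rewrite big_cons mulmxA.
have [wAU _|wAU wsU] := boolP (w *m (A - a%:M) <= U)%MS.
  by exists a, w => //; rewrite wW.
apply: IHs wAU wsU; rewrite mulmxBr addmx_sub ?eqmx_opp //.
  exact: submx_trans (submxMr A wW) stabW.
by rewrite mul_mx_scalar scalemx_sub.
Qed.

(** An invariant W not contained in U, of least rank, consists of common
    eigenvectors modulo U: for each A i, the vectors of W that some A i - a
    sends into U form an invariant subspace by commutation, which cannot be
    smaller than W. *)
Lemma common_eigenvector_mod (F : closedFieldType) (I : Type) (n k : nat)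
    (A : I -> 'M[F]_n) (U : 'M[F]_(k, n)) :
  (forall i j, A i *m A j = A j *m A i) -> (forall i, stablemx U (A i)) ->
  (\rank U < n)%N ->
  exists2 v : 'rV[F]_n, ~~ (v <= U)%MS &
    forall i, exists a, (v *m (A i - a%:M) <= U)%MS.
Proof.
move=> commA stabU rankU.
have: ~~ ((1%:M : 'M[F]_n) <= U)%MS by rewrite sub1mx /row_full neq_ltn rankU.
have: forall i, stablemx (1%:M : 'M[F]_n) (A i) by move=> i; exact: submx1.
have: (U <= (1%:M : 'M[F]_n))%MS by exact: submx1.
(* The induction runs over the invariant W, starting from the whole space. *)
move: {2}(\rank _).+1 (ltnSn (\rank (1%:M : 'M[F]_n))) => r.
elim: r (1%:M : 'M[F]_n) => // r IHr W rankW UW stabW WU.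
have [eigW|] := pselect (forall i, exists a, (W *m (A i - a%:M) <= U)%MS).
  have /row_subPn[j WjU] := WU; exists (row j W) => // i.
  have [a WaU] := eigW i; exists a.
  exact: submx_trans (submxMr _ (row_sub j W)) WaU.
move=> /existsNP[i /forallNP noeig].
have [a [w /andP[wW wU] waU]] := eigenvector_mod (stabW i) WU.
pose E := kermx ((A i - a%:M) *m cokermx U).
have inE m (v : 'M_(m, n)) : (v <= E)%MS = (v *m (A i - a%:M) <= U)%MS.
  by rewrite sub_kermx mulmxA -submxE.
have commAi j : (A i - a%:M) *m A j = A j *m (A i - a%:M).
  by rewrite mulmxBl mulmxBr commA scalar_mxC.
apply: (IHr (W :&: E)%MS).
- rewrite -ltnS; apply: leq_trans rankW; rewrite ltnS; apply: rank_ltmx.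
  rewrite ltmxE capmxSl /= sub_capmx submx_refl /= inE; exact/negP/noeig.
- rewrite sub_capmx UW inE mulmxBr addmx_sub ?eqmx_opp ?stabU //.
  by rewrite mul_mx_scalar scalemx_sub.
- move=> j; rewrite sub_capmx (submx_trans (submxMr _ (capmxSl _ _))) ?stabW //.
  rewrite inE -mulmxA -commAi mulmxA (submx_trans _ (stabU j)) // submxMr //.
  by rewrite -inE capmxSr.
- apply: contra wU; apply: submx_trans; by rewrite sub_capmx wW inE.
Qed.

(** * The topology of the complex numbers in real coordinates *)

Lemma normc_real (R : realType) (t : R) : `|t%:C| = `|t|%:C.
Proof. by rewrite normc_def /= expr0n addr0 sqrtr_sqr. Qed.

Lemma gtc0_real (R : realType) (e : R[i]) :
  0 < e -> exists2 r : R, 0 < r & e = r%:C.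
Proof. by case: e => a b; rewrite ltcE /= => /andP[/eqP-> a0]; exists a. Qed.

Lemma real_complex_continuous (R : realType) :
  continuous (fun t : R => t%:C : R[i]^o).
Proof.
move=> t; apply/cvgrPdist_lt => /= e /gtc0_real[r r0 ->].
near=> u; rewrite -rmorphB /= normc_real ltcR; near: u.
exact: cvgr_dist_lt.
Unshelve. all: by end_near. Qed.

Lemma Re_continuous (R : realType) :
  continuous (fun z : R[i]^o => complex.Re z).
Proof.
move=> z; apply/(@cvgrPdist_lt _ R^o _ _ (nbhs_filter z)) => e e0.
apply/(@nbhs_normP R[i] R[i]^o); exists e%:C => [|u /=].
  by rewrite /= ltcR.
rewrite -ltcR -raddfB /=; exact: le_lt_trans (normc_ge_Re _).
Qed.

Lemma normc_continuous (R : realType) (p : R[i]) :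
  continuous (fun z : R[i]^o => normc (z - p)).
Proof.
move=> z.
apply: (@continuous_comp _ R[i]^o _ (fun v : R[i]^o => `|v - p|)
  (@complex.Re R)).
  apply: (@cvg_norm _ R[i]^o _ _ (nbhs_filter z)).
  apply: (@cvgB _ R[i]^o _ _ (nbhs_filter z)); [exact: cvg_id|exact: cvg_cst].
exact: Re_continuous.
Qed.

(** * Linear maps out of a finite-dimensional Hausdorff space are continuous *)

Lemma continuous_linear_combination (R : realType) (T : topologicalType)
    (Y : topologicalLmodType R[i]) (I : Type) (s : seq I)
    (a : I -> T -> R[i]^o) (y : I -> Y) :
  (forall i, continuous (a i)) ->
  continuous (fun t => \sum_(i <- s) a i t *: y i).
Proof.
move=> ca; elim: s => [|i s IHs] t.
  rewrite (_ : (fun _ => _) = cst 0); first exact: cvg_cst.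
  by apply/funext => u; rewrite big_nil.
rewrite (_ : (fun _ => _) =
    fun t => a i t *: y i + \sum_(j <- s) a j t *: y j); last first.
  by apply/funext => u; rewrite big_cons.
apply: (@continuous2_cvg T Y Y Y (nbhs t) _ _ _ +%R).
- exact: (@add_continuous Y (_, _)).
- apply: (@continuous2_cvg T R[i]^o Y Y (nbhs t) _ _ _ *:%R).
  + exact: (@scale_continuous R[i] Y (_, _)).
  + exact: ca.
  + exact: cvg_cst.
- exact: IHs.
Qed.

Section FinDim.
Variables (R : realType) (X : finDimTopLmodType R[i]).
Let n := dim X.

(** In real coordinates the spheres are bounded closed sets of real row vectors,
    hence compact. *)
Definition real_coords (x : X) : 'rV[R]_(n + n) :=
  row_mx (map_mx (@complex.Re R) (v2r x)) (map_mx (@complex.Im R) (v2r x)).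

Definition of_real_coords (v : 'rV[R]_(n + n)) : X :=
  @r2v _ X (map2_mx (@Complex R) (lsubmx v) (rsubmx v)).

Lemma real_coordsK : cancel real_coords of_real_coords.
Proof.
move=> x; rewrite /of_real_coords row_mxKl row_mxKr.
apply: (can_inj v2rK); rewrite r2vK; apply/rowP => i; rewrite !mxE.
by case: (v2r x 0 i).
Qed.

Lemma of_real_coordsK : cancel of_real_coords real_coords.
Proof.
move=> v; rewrite /real_coords r2vK -[RHS]hsubmxK; congr row_mx;
  by apply/rowP => i; rewrite !mxE.
Qed.

Lemma of_real_coordsZ (t : R) v :
  of_real_coords (t *: v) = t%:C *: of_real_coords v.
Proof.
rewrite -linearZ /=; congr r2v; apply/rowP => i; rewrite !mxE.
by rewrite /GRing.mul /= !mul0r subr0 addr0.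
Qed.

Lemma linear_of_real_coords_continuous (Y : topologicalLmodType R[i])
    (f : {linear X -> Y}) : continuous (f \o of_real_coords).
Proof.
have -> : f \o of_real_coords = fun v => \sum_(i < n)
      ((v 0 (lshift n i))%:C + 'i * (v 0 (rshift n i))%:C)
        *: f (@r2v _ X (delta_mx 0 i)).
  apply/funext => v /=; rewrite /of_real_coords [X in r2v X]row_sum_delta.
  rewrite !linear_sum; apply: eq_bigr => i _; rewrite !linearZ /=.
  by congr (_ *: _); rewrite !mxE [LHS]complexE.
apply: continuous_linear_combination => i v.
have cre j : (fun w : 'rV[R]_(n + n) => (w 0 j)%:C : R[i]^o) w @[w --> v] -->
    ((v 0 j)%:C : R[i]^o).
  apply: (continuous_comp (f := fun w : 'rV[R]_(n + n) => w 0 j)).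
    exact: coord_continuous.
  exact: real_complex_continuous.
apply: (@cvgD _ R[i]^o) (cre _) _.
apply: (@cvgM R[i]) (cre _).
exact: cvg_cst.
Qed.

(** The image S of the sphere of radius d is compact, hence closed, and misses 0.
    By continuity of scaling at (0, 0), all the multiples t *: x with t in [0, 1]
    of a vector x close to 0 avoid S; were the coordinates of x of norm at least
    d, one of these multiples would lie on S. *)
Lemma real_coords_near0 (hX : hausdorff_space X) (d : R) : 0 < d ->
  \forall x \near (0 : X), `|real_coords x| < d.
Proof.
move=> d0.
pose S := of_real_coords @` [set v | `|v| = d].
have S_closed : closed S.
  apply: compact_closed => //; apply: continuous_compact.
    apply: continuous_subspaceT.
    exact: (@linear_of_real_coords_continuous X (idfun : {linear X -> X})).
  apply: bounded_closed_compact.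
    exists d; split; first exact: num_real.
    by move=> M dM v /= ->; apply: ltW.
  rewrite (_ : [set _ | _] = (@Num.norm R 'rV[R]_(n + n)) @^-1` [set d]) //.
  apply: closed_comp; last exact: closed_eq.
  by move=> v _; exact: norm_continuous.
have S0 : nbhs (0 : X) (~` S).
  apply: open_nbhs_nbhs; split; first exact: closed_openC.
  move=> [v /= vd v0]; have vE : v = 0.
    by rewrite -[v]of_real_coordsK v0 /real_coords linear0 !raddf0 ?row_mx0 //.
  by rewrite -vd vE normr0 ltxx in d0.
have := @scale_continuous R[i] X (0, 0) (~` S).
rewrite /= scale0r => /(_ S0)[[A B] /= [A0 B0] AB].
have [r r0 rA] : exists2 r : R, 0 < r & forall t : R, 0 <= t <= r -> A t%:C.
  have [_ /gtc0_real[e e0 ->] eA] := (@nbhs_normP R[i] R[i]^o _ _).1 A0.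
  exists (e / 2) => [|t /andP[t0 te]]; first exact: divr_gt0.
  apply: eA => /=; rewrite sub0r normrN normc_real ltcR ger0_norm //.
  by apply: le_lt_trans te _; rewrite ltr_pdivrMr // ltr_pMr // ltr1n.
have rB : nbhs (0 : X) ((fun x => (r^-1)%:C *: x) @^-1` B).
  suff: (r^-1)%:C *: x @[x --> (0 : X)] --> (r^-1)%:C *: (0 : X).
    by rewrite scaler0; apply.
  apply: (@continuous2_cvg X R[i]^o X X (nbhs 0) _ _ _ *:%R).
  - exact: (@scale_continuous R[i] X (_, _)).
  - exact: cvg_cst.
  - exact: cvg_id.
apply: filterS rB => x xB; rewrite ltNge; apply/negP => dx.
have x0 : 0 < `|real_coords x| := lt_le_trans d0 dx.
(* The factor that brings x onto S. *)
pose t := d / `|real_coords x|.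
have t0 : 0 <= t by rewrite divr_ge0 // ltW.
have t1 : t <= 1 by rewrite ler_pdivrMr // mul1r.
apply: (AB ((t * r)%:C, (r^-1)%:C *: x)).
  split => //=; apply: rA; rewrite mulr_ge0 //=; last exact: ltW.
  by rewrite ler_piMl // ltW.
rewrite /= scalerA -rmorphM /= mulfK ?gt_eqF //.
exists (t *: real_coords x); last by rewrite of_real_coordsZ real_coordsK.
by rewrite /= normrZ ger0_norm // divfK ?gt_eqF.
Qed.

Lemma linear_continuous_findim (hX : hausdorff_space X)
  (Y : topologicalLmodType R[i]) (f : {linear X -> Y}) : continuous f.
Proof.
have f0 : f y @[y --> (0 : X)] --> (0 : Y).
  move=> W W0.
  have := @linear_of_real_coords_continuous Y f 0 W.
  rewrite /= -[X in of_real_coords X](scale0r 0) of_real_coordsZ.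
  rewrite scale0r linear0.
  move=> /(_ W0) /nbhs_ballP[d d0 dW].
  apply: filterS (real_coords_near0 hX d0) => x xd.
  have := dW (real_coords x).
  rewrite -ball_normE /= sub0r normrN real_coordsK; exact.
move=> x.
have -> : f = (fun y => f (y - x) + f x) :> (X -> Y).
  by apply/funext => y; rewrite -linearD subrK.
rewrite /continuous_at subrr linear0.
apply: (@continuous2_cvg X Y Y Y (nbhs x) _ _ _ +%R).
- exact: (@add_continuous Y (_, _)).
- apply: cvg_comp f0; rewrite -(subrr x).
  apply: (@continuous2_cvg X X X X (nbhs x) _ _ _ (fun a b => a - b)).
  + exact: (@sub_continuous X (_, _)).
  + exact: cvg_id.
  + exact: cvg_cst.
- exact: cvg_cst.
Qed.

End FinDim.

(** * Continuous additive and multiplicative functions on the half-line *)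

(** The difference g between h and the linear function with the same value at 1
    is additive and vanishes at 1, so it is periodic and thus bounded, being
    continuous; but g (k * t) = k * g t, so g vanishes. *)
Lemma additive_halfline_linear (R : realType) (h : R -> R) :
  continuous h ->
  (forall t s, 0 <= t -> 0 <= s -> h (t + s) = h t + h s) ->
  forall t, 0 <= t -> h t = t * h 1.
Proof.
move=> ch hD; pose g t := h t - t * h 1.
have gD t s : 0 <= t -> 0 <= s -> g (t + s) = g t + g s.
  by move=> t0 s0; rewrite /g hD // mulrDl opprD addrACA.
have g1 : g 1 = 0 by rewrite /g mul1r subrr.
have gM k t : 0 <= t -> g (k%:R * t) = k%:R * g t.
  move=> t0; elim: k => [|k IHk].
    by rewrite !mul0r; apply: (addrI (g 0)); rewrite -gD // !addr0.
  by rewrite -natr1 !mulrDl !mul1r gD ?IHk // mulr_ge0.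
have [M [_ gM1]] : bounded_set (g @` `[0, 1]).
  apply: compact_bounded.
  apply: continuous_compact (segment_compact (a := 0) (b := 1)).
  apply: continuous_subspaceT => t; apply: cvgB (ch t) _.
  by apply: cvgM cvg_id _; exact: cvg_cst.
have gM2 t : 0 <= t -> `|g t| <= `|M| + 1.
  move=> t0; pose k := Num.truncn t.
  have /andP[kt tk] := truncn_itv t0.
  have -> : g t = g (t - k%:R).
    have gk : g k%:R = 0 by rewrite -[k%:R]mulr1 gM // g1 mulr0.
    by rewrite -[in LHS](subrK k%:R t) (gD _ k%:R) ?subr_ge0 // gk addr0.
  apply: (gM1 (`|M| + 1)).
    by apply: le_lt_trans (ler_norm M) _; rewrite ltrDl.
  exists (t - k%:R) => //=.
  by rewrite in_itv /= subr_ge0 kt lerBlDl ltW // natr1.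
move=> t t0; apply/eqP; rewrite -subr_eq0 -/(g t) -normr_le0 leNgt.
apply/negP => gt_pos; pose k := (Num.truncn ((`|M| + 1) / `|g t|)).+1.
have := gM2 (k%:R * t) (mulr_ge0 (ler0n _ _) t0).
rewrite gM // normrM normr_nat -ler_pdivlMr // leNgt => /negP; apply.
exact: truncnS_gt.
Qed.

(** If c t = 0 then c (t / k) is a k-th root of 0 for all k > 0, while c is
    close to 1 near 0. *)
Lemma multiplicative_halfline_gt0 (R : realType) (c : R -> R) :
  continuous c -> (forall t, 0 <= c t) -> c 0 = 1 ->
  (forall t s, 0 <= t -> 0 <= s -> c (t + s) = c t * c s) ->
  forall t, 0 <= t -> 0 < c t.
Proof.
move=> cc c_ge0 c0 cM t t0; rewrite lt_def c_ge0 andbT; apply/eqP => ct.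
have /nbhs_ballP[d /= d0 dc] : nbhs (0 : R) (c @^-1` [set y | 0 < y]).
  apply: (cc 0); apply: open_nbhs_nbhs; split; first exact: open_gt.
  by rewrite /= c0.
pose k := (Num.truncn (t / d)).+1.
have cX j s : 0 <= s -> c (j%:R * s) = c s ^+ j.
  move=> s0; elim: j => [|j IHj]; first by rewrite mul0r c0.
  by rewrite -natr1 mulrDl mul1r cM ?mulr_ge0 // IHj exprSr.
have : 0 < c (t / k%:R).
  apply: dc; rewrite -ball_normE /= sub0r normrN ger0_norm ?divr_ge0 //.
  by rewrite ltr_pdivrMr ?ltr0n // mulrC -ltr_pdivrMr //; exact: truncnS_gt.
move=> /(exprn_gt0 k); rewrite -cX ?divr_ge0 //.
by rewrite mulrC divfK ?pnatr_eq0 // ct ltxx.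
Qed.

(** The logarithm of c is additive, hence linear. *)
Lemma multiplicative_halfline_monotone (R : realType) (c : R -> R) :
  continuous c -> (forall t, 0 <= c t) -> c 0 = 1 ->
  (forall t s, 0 <= t -> 0 <= s -> c (t + s) = c t * c s) ->
  (forall t, 0 <= t -> c t <= 1) \/ (forall t, 0 <= t -> 1 <= c t).
Proof.
move=> cc c_ge0 c0 cM.
have c_gt0 := multiplicative_halfline_gt0 cc c_ge0 c0 cM.
pose h (t : R) := ln (c `|t|).
have hE : forall t, 0 <= t -> h t = t * h 1.
  apply: additive_halfline_linear => [t|t s t0 s0].
    apply: (@continuous_comp R R R (fun u => c `|u|) (@ln R)).
      apply: (@continuous_comp R R R (fun u : R => `|u|) c); last exact: cc.
      exact: (@norm_continuous R R^o).
    exact/continuous_ln/c_gt0.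
  by rewrite /h !ger0_norm ?addr_ge0 // cM // lnM // posrE c_gt0.
have [h1|/ltW h1] := leP (h 1) 0; [left|right] => t t0.
  rewrite -ler_ln ?posrE ?c_gt0 // ln1 -[t]ger0_norm // -/(h t) hE //.
  exact: mulr_ge0_le0.
rewrite -ler_ln ?posrE ?c_gt0 // ln1 -[t]ger0_norm // -/(h t) hE //.
exact: mulr_ge0.
Qed.

(** * Orbits of affine semigroups of the complex plane are not dense *)

(** The hypothesis says that z is the orbit of z 0 under affine maps of linear
    parts m t that commute along this orbit, because z (t + s) = z (s + t).  If
    all the m t are 1 they act as translations.  If m s != 1 for some s, the
    fixed point p of the map of index s is fixed by all of them, so that
    z t - p = m t * q with q = z 0 - p. *)
Lemma affine_orbit_avoids (R : realType) (z : R -> R[i]^o) (m : R -> R[i]) :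
  continuous z ->
  (forall t s, 0 <= t -> 0 <= s -> z (t + s) - z t = m t * (z s - z 0)) ->
  exists O : set R[i]^o,
    [/\ open O, O !=set0 & forall t, 0 <= t -> ~ O (z t)].
Proof.
move=> cz zD; pose w t := z t - z 0.
have zE t : z t = w t + z 0 by rewrite subrK.
have wD t s : 0 <= t -> 0 <= s -> w (t + s) = w t + m t * w s.
  by move=> t0 s0; rewrite /w -zD // [RHS]addrC addrA subrK.
have wC t s : 0 <= t -> 0 <= s -> (m t - 1) * w s = (m s - 1) * w t.
  move=> t0 s0; have E : w t + m t * w s = w s + m s * w t.
    by rewrite -wD // -wD // addrC.
  rewrite !mulrBl !mul1r; apply/eqP.
  rewrite subr_eq -[X in X == _](addKr (w t)) E.
  by rewrite addrCA addrC [- w t + _]addrC.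
have open_gtc (p : R[i]) r : open [set v : R[i]^o | r < normc (v - p)].
  apply: (@open_comp _ _ _ [set y : R | r < y]); last exact: open_gt.
  by move=> ? _; exact: normc_continuous.
have open_ltc (p : R[i]) r : open [set v : R[i]^o | normc (v - p) < r].
  apply: (@open_comp _ _ _ [set y : R | y < r]); last exact: open_lt.
  by move=> ? _; exact: normc_continuous.
have [m1|] := pselect (forall t, 0 <= t -> m t = 1).
  pose h t := complex.Re (w t).
  have hE : forall t, 0 <= t -> h t = t * h 1.
    apply: additive_halfline_linear => [t|t s t0 s0].
      apply: (@continuous_comp _ R[i]^o _ w (@complex.Re R));
        last exact: Re_continuous.
      by apply: (@cvgB _ R[i]^o); [exact: cz|exact: cvg_cst].
    by rewrite /h wD // m1 // mul1r raddfD.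
  have [h1|/ltW h1] := leP (h 1) 0.
    exists [set v | complex.Re (z 0) < complex.Re v]; split.
    - apply: (@open_comp _ _ _ [set y : R | complex.Re (z 0) < y]);
        last exact: open_gt.
      by move=> ? _; exact: Re_continuous.
    - by exists (z 0 + 1); rewrite /= raddfD ltrDl /= ltr01.
    - move=> t t0 /=; rewrite (zE t) raddfD /= -/(h t) hE // ltNge gerDr.
      by rewrite mulr_ge0_le0.
  exists [set v | complex.Re v < complex.Re (z 0)]; split.
  - apply: (@open_comp _ _ _ [set y : R | y < complex.Re (z 0)]);
      last exact: open_lt.
    by move=> ? _; exact: Re_continuous.
  - by exists (z 0 - 1); rewrite /= raddfB /= gtrBl ltr01.
  - move=> t t0 /=; rewrite (zE t) raddfD /= -/(h t) hE // ltNge lerDr.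
    by rewrite mulr_ge0.
move=> /existsNP[s] /not_implyP[s0 /eqP ms1].
pose q := w s / (m s - 1); pose p := z 0 - q.
have zp t : 0 <= t -> z t - p = m t * q.
  move=> t0; rewrite zE /p opprB [q - _]addrC addrA addrK.
  have -> : w t = (m t - 1) * q.
    by rewrite /q mulrA wC // mulrAC divff ?mul1r ?subr_eq0.
  by rewrite mulrBl mul1r subrK.
(* When z starts at the fixed point it is constant. *)
have [q0|q0] := eqVneq q 0.
  exists [set v | 0 < normc (v - p)]; split => //.
    by exists (p + 1); rewrite /= [p + 1]addrC addrK normc1 ltr01.
  by move=> t t0 /=; rewrite zp // q0 mulr0 normc0 ltxx.
have nq0 : 0 < normc q by rewrite -ltcR (normr_gt0 (q : R[i])).
(* On the half-line c t is the modulus of m t; this form of it is visibly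
   continuous. *)
pose c t := normc ((z t - p) / q).
have cE t : 0 <= t -> c t = normc (m t) by move=> t0; rewrite /c zp // mulfK.
have mM t r : 0 <= t -> 0 <= r -> m (t + r) = m t * m r.
  move=> t0 r0; apply: (mulIf q0); rewrite -zp ?addr_ge0 // -mulrA -zp //.
  rewrite -(subrK (z t) (z (t + r))) zD // -addrA (zp t) // -mulrDr.
  by rewrite /p opprB [q - _]addrC addrA.
have zpc t : 0 <= t -> normc (z t - p) = c t * normc q.
  by move=> t0; rewrite zp // normcM cE.
have [] := @multiplicative_halfline_monotone R c.
- move=> t; rewrite /c.
  have -> : (fun t => normc ((z t - p) / q)) =
      (fun t => normc (z t - p) / normc q).
    by apply/funext => r; rewrite normcM normcV.
  apply: cvgM; last exact: cvg_cst.
  apply: (@continuous_comp _ R[i]^o _ z (fun v => normc (v - p)));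
    first exact: cz.
  exact: normc_continuous.
- by move=> t; rewrite /c -ler0c; exact: (normr_ge0 (_ : R[i])).
- by rewrite /c /p opprB addrC subrK divff // normc1.
- by move=> t r t0 r0; rewrite !cE ?addr_ge0 // mM // normcM.
- move=> c1; exists [set v | normc q < normc (v - p)]; split => //.
    exists (p + q *+ 2); rewrite /= [p + _]addrC addrK.
    by rewrite normcMn mulr2n ltrDl.
  by move=> t t0 /=; rewrite zpc // ltNge ler_piMl ?c1 // ltW.
- move=> c1; exists [set v | normc (v - p) < normc q]; split => //.
    by exists p; rewrite /= subrr normc0.
  by move=> t t0 /=; rewrite zpc // ltNge ler_peMl ?c1 // ltW.
Qed.

(** * Linear functionals in coordinates *)

Section Covectors.
Variables (R : realType) (X : finDimTopLmodType R[i]).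
Implicit Types (u v : 'rV[R[i]]_(dim X)) (x : X).

Definition covector u x : R[i] := (v2r x *m u^T) 0 0.

Fact covector_is_linear u : linear (covector u).
Proof. by move=> a x y; rewrite /covector linearP mulmxDl -scalemxAl !mxE. Qed.

HB.instance Definition _ u :=
  GRing.isLinear.Build R[i] X R[i]^o *:%R (covector u) (covector_is_linear u).

Lemma covectorDl u v x : covector (u + v) x = covector u x + covector v x.
Proof. by rewrite /covector linearD mulmxDr mxE. Qed.

Lemma covectorZl a u x : covector (a *: u) x = a * covector u x.
Proof. by rewrite /covector linearZ -scalemxAr mxE. Qed.

Lemma covectorDr u x y : covector u (x + y) = covector u x + covector u y.
Proof. exact: raddfD. Qed.

Lemma covectorZr a u x : covector u (a *: x) = a * covector u x.
Proof. exact: linearZ. Qed.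

(** The columns of the cokernel of U are killed by all the rows of U, and one of
    them is not killed by u. *)
Lemma covector_separates k (U : 'M[R[i]]_(k, dim X)) u : ~~ (u <= U)%MS ->
  exists2 x, covector u x != 0 & forall v, (v <= U)%MS -> covector v x = 0.
Proof.
rewrite submxE => /eqP/rowP/existsNP[j]; rewrite [RHS]mxE => /eqP uj.
have xE v : covector v (r2v (col j (cokermx U))^T) = (v *m cokermx U) 0 j.
  rewrite /covector r2vK -trmx_mul [LHS]mxE !mxE.
  by apply: eq_bigr => i _; rewrite mxE.
exists (r2v (col j (cokermx U))^T); first by rewrite xE.
by move=> v; rewrite submxE xE => /eqP->; rewrite mxE.
Qed.

Lemma covector_lin1_mx u (f : {linear X -> X}) x :
  covector u (f x) = covector (u *m (lin1_mx (v2r \o f \o r2v))^T) x.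
Proof. by rewrite /covector trmx_mul trmxK mulmxA mul_rV_lin1 /= v2rK. Qed.

End Covectors.

(** * Orbits of a semigroup *)

Section Orbits.
Variables (R : realType) (X : finDimTopLmodType R[i]).
Variables (T : R -> X -> X) (T_C0 : C0_semigroup T).

(** The absolute value extends the semigroup to all real indices, so that the
    operators form a total family of linear maps, with orbits continuous on the
    whole real line. *)
Definition flow (t : R) := T `|t|.

Fact flow_is_linear t : linear (flow t).
Proof. exact: (C0_linear T_C0 (normr_ge0 t)). Qed.

HB.instance Definition _ t :=
  GRing.isLinear.Build R[i] X X *:%R (flow t) (flow_is_linear t).

(** The commuting transposes of the operators have a common eigenvector u, then
    a common eigenvector v modulo the line of u, which is proper in dimension at
    least 2. *)
Lemma triangular_covectors : (1 < dim X)%N ->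
  exists u v : 'rV[R[i]]_(dim X), [/\ u != 0, ~~ (v <= u)%MS &
    exists l m n : R -> R[i], forall t x, 0 <= t ->
      covector u (T t x) = l t * covector u x /\
      covector v (T t x) = m t * covector v x + n t * covector u x].
Proof.
move=> X_dim; pose A t := (lin1_mx (v2r \o flow t \o r2v))^T.
have AP u t x : covector u (flow t x) = covector (u *m A t) x.
  exact: covector_lin1_mx.
have AC t s : A t *m A s = A s *m A t.
  rewrite -!trmx_mul; congr trmx; apply/row_matrixP => i.
  rewrite !rowE !mulmxA !mul_rV_lin1 /= !v2rK; congr v2r.
  rewrite /flow -[LHS]/((T `|t| \o T `|s|) _) -[RHS]/((T `|s| \o T `|t|) _).
  by rewrite -!(C0_comp T_C0) // addrC.
have sub0E (w : 'rV[R[i]]_(dim X)) :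
    (w <= (0 : 'M[R[i]]_(1, dim X)))%MS = (w == 0).
  apply/idP/eqP => [/submxP[D ->]|->]; [exact: mulmx0|exact: sub0mx].
have [||u] := common_eigenvector_mod (U := 0 : 'M[R[i]]_(1, dim X)) AC.
- by move=> t; rewrite mul0mx.
- by rewrite mxrank0 ltnW.
rewrite sub0E => u0 /choice[l ul].
have uA t : u *m A t = l t *: u.
  have := ul t; rewrite sub0E mulmxBr mul_mx_scalar subr_eq0.
  by move/eqP.
have [||v vu /choice[m vm]] := common_eigenvector_mod (U := u) AC.
- by move=> t; rewrite uA scalemx_sub.
- exact: leq_ltn_trans (rank_leq_row u) X_dim.
have /choice[n vA] : forall t, exists a, v *m A t = m t *: v + a *: u.
  move=> t; have /sub_rVP[a E] := vm t; exists a.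
  by rewrite -E mulmxBr mul_mx_scalar addrC subrK.
exists u, v; split => //; exists l, m, n => t x t0.
have -> : T t = flow t by rewrite /flow ger0_norm.
by rewrite !AP uA vA covectorDl !covectorZl.
Qed.

Lemma flow_continuous (x : X) : continuous (flow^~ x).
Proof.
move=> t P /(C0_strongly_continuous T_C0 (normr_ge0 t)).
move=> /(@norm_continuous R R^o t).
by apply: (@filterS R (nbhs t) (nbhs_filter t)) => s /= Ps; exact/Ps/normr_ge0.
Qed.

End Orbits.

Theorem theorem4p2 (R : realType) (X : finDimTopLmodType R[i])
    (X_hausdorff : hausdorff_space X) (X_dim : (2 <= \dim {: X})%N)
    (T : R -> X -> X) (T_C0 : C0_semigroup T) :
  ~ codiskcyclic T.
Proof.
rewrite dimvf in X_dim.
have [u [v [u0 vu [l [m [n uvT]]]]]] := triangular_covectors T_C0 X_dim.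
have covc w : continuous (covector w : X -> R[i]^o).
  exact: (linear_continuous_findim X_hausdorff
    (f := covector w : {linear X -> R[i]^o})).
have orbc w x : continuous (fun t : R => covector w (flow T t x) : R[i]^o).
  move=> t; apply: (@continuous_comp _ _ _ (fun t => flow T t x)).
    exact: flow_continuous.
  exact: covc.
have [y0 uy0] : exists y0 : X, covector u y0 = 1.
  have [|y uy _] := @covector_separates R X 1 0 u.
    by apply: contra u0 => /submxP[D ->]; rewrite mulmx0.
  by exists ((covector u y)^-1 *: y); rewrite covectorZr mulVf.
have [y1 vy1 uy1] : exists2 y1 : X, covector v y1 = 1 & covector u y1 = 0.
  have [y vy uy] := covector_separates vu.
  exists ((covector v y)^-1 *: y); rewrite covectorZr; first exact: mulVf.
  by rewrite (uy u (submx_refl _)) mulr0.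
have u_open : open [set y : X | covector u y != 0].
  apply: (@open_comp X R[i]^o (covector u) [set w | w != 0]).
    by move=> y _; exact: covc.
  rewrite (_ : [set w | w != 0] = ~` [set (0 : R[i]^o)]); last first.
    by apply/seteqP; split=> w /= /eqP.
  apply/closed_openC/accessible_closed_set1/hausdorff_accessible.
  exact: (@norm_hausdorff R[i] R[i]^o).
move=> [x x_dense].
(* Otherwise the projective orbit of x lies in the hyperplane u = 0. *)
have ux : covector u x != 0.
  have [|y [/= uy [a _ [t t0 aT]]]] := x_dense _ _ u_open.
    by exists y0; rewrite /= uy0 oner_neq0.
  apply: contraNneq uy => ux.
  by rewrite -aT covectorZr (uvT _ _ t0).1 ux !mulr0.
(* The modulus of l t on the half-line, extended continuously to the line. *)
pose c (t : R) := normc (covector u (flow T t x) / covector u x).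
have cE t : 0 <= t -> c t = normc (l t).
  by move=> t0; rewrite /c /flow ger0_norm // (uvT _ _ t0).1 mulfK.
have Tadd t s : 0 <= t -> 0 <= s -> T (t + s) x = T t (T s x).
  by move=> t0 s0; rewrite (C0_comp T_C0).
have lD t s : 0 <= t -> 0 <= s -> l (t + s) = l t * l s.
  move=> t0 s0; apply: (mulIf ux).
  rewrite -(uvT _ _ (addr_ge0 t0 s0)).1 Tadd // (uvT _ _ t0).1 (uvT _ _ s0).1.
  exact: mulrA.
have l0 t : 0 <= t -> l t != 0.
  move=> t0; suff: 0 < c t.
    by rewrite cE //; apply: contraTneq => ->; rewrite normc0 ltxx.
  apply: multiplicative_halfline_gt0 t0.
  - rewrite (_ : c = fun t : R =>
        normc (covector u (flow T t x) - 0) / normc (covector u x)).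
      move=> r; apply: cvgM; last exact: cvg_cst.
      apply: (@continuous_comp R R[i]^o R (fun t => covector u (flow T t x))
        (fun w => normc (w - 0))); first exact: orbc.
      exact: normc_continuous.
    by apply/funext => r; rewrite subr0 /c normcM normcV.
  - by move=> s; rewrite /c -ler0c; exact: (normr_ge0 (_ : R[i])).
  - by rewrite /c /flow normr0 (C0_id T_C0) divff // normc1.
  - by move=> r s r0 s0; rewrite !cE ?addr_ge0 // lD // normcM.
pose ratio y : R[i]^o := covector v y / covector u y.
have ratioc y : covector u y != 0 -> {for y, continuous ratio}.
  move=> uy; rewrite /ratio /continuous_at.
  apply: (@cvgM R[i]); first exact: covc.
  apply: (@cvgV R[i]) => //; exact: covc.
pose z (t : R) := ratio (flow T t x).
have uT t : 0 <= t -> covector u (T t x) != 0.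
  by move=> t0; rewrite (uvT _ _ t0).1 mulf_neq0 ?l0.
have zE t : 0 <= t -> z t = ratio (T t x).
  by move=> t0; rewrite /z /flow ger0_norm.
have zc : continuous z.
  move=> t; apply: (@continuous_comp _ _ _ (fun t => flow T t x)).
    exact: flow_continuous.
  exact/ratioc/uT.
have zD t s : 0 <= t -> 0 <= s -> z (t + s) = m t / l t * z s + n t / l t.
  move=> t0 s0; rewrite !zE ?addr_ge0 // Tadd // /ratio.
  have [-> ->] := uvT t (T s x) t0.
  rewrite invfM mulrDl [X in _ + X]mulrACA divff ?uT // mulr1.
  by rewrite [X in X + _]mulrACA.
have [|O [O_open [o Oo] Oz]] :=
    affine_orbit_avoids (m := fun t => m t / l t) zc.
  move=> t s t0 s0; rewrite zD // -[in z t](addr0 t) zD // mulrBr.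
  by rewrite opprD addrACA subrr addr0.
pose O' : set X := [set y | covector u y != 0 /\ O (ratio y)].
have O'_open : open O'.
  rewrite openE => y [uy Oy]; apply: filterI.
    by apply: open_nbhs_nbhs; split.
  by apply: (ratioc y uy); apply: open_nbhs_nbhs; split.
have [|y [[uy Oy] [a _ [t t0 aT]]]] := x_dense _ _ O'_open.
  (* A vector with u = 1 and v = o, so that its ratio is o. *)
  exists (y0 + (o - covector v y0) *: y1).
  rewrite /O' /ratio /= !covectorDr !covectorZr /= uy0 uy1 vy1 mulr0 addr0.
  by rewrite divr1 mulr1 addrC subrK oner_neq0.
apply: (Oz t t0); rewrite zE //; move: uy Oy; rewrite -aT /ratio !covectorZr.
rewrite mulf_eq0 => /norP[a0 _].
by rewrite -mulf_div divff // mul1r.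
Qed.
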